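(* Let $G$ be a finite group, let $H$ be a nonnormal T.I. subgroup of $G$, and let $\pi$ be the set of primes dividing $|H|$. Assume that $G$ is $\pi$-separable and that $H$ is a Hall subgroup of $N_G(H)$. Assume further that a Sylow $2$-subgroup of $H$ is abelian and that $Q$ is a complement of $H$ in $N_G(H)$. Then $C_H(Q)$ is a Hall subgroup of $G$ having a normal complement in $G$.
   Context: A subgroup $H$ of a group $G$ is a T.I. subgroup if for every $x\in G$ the intersection $H\cap H^x$ is either $H$ or trivial. A Hall subgroup is a subgroup whose order is coprime to its index. $G$ is $\pi$-separable if it has a normal series each of whose factors is a $\pi$-group or a $\pi'$-group. A complement of $H$ in $N_G(H)$ is a subgroup $Q$ with $N_G(H)=HQ$ and $H\cap Q=1$; a normal complement of a subgroup $C$ in $G$ is a normal subgroup $N$ of $G$ with $G=NC$ and $N\cap C=1$. *)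

(* Defs.v *)
From HB Require Import structures.
From mathcomp Require Import all_boot all_fingroup all_solvable.

Set Implicit Arguments.
Unset Strict Implicit.
Unset Printing Implicit Defensive.

Local Open Scope group_scope.

Definition TI_subgroup (gT : finGroupType) (G H : {set gT}) : Prop :=
  H \subset G /\
  forall x, x \in G -> H :&: H :^ x = H \/ H :&: H :^ x = 1.

Definition pi_factor (gT : finGroupType) (pi : nat_pred) (A B : {group gT}) :
  bool := (A \subset B) && (pi.-group (B / A) || pi^'.-group (B / A)).

(* The series is 1 :: s, increasing from 1 to G.  Each term is normal in G, so
   B / A is the true factor group whenever A and B are consecutive terms. *)
Definition pi_separable (gT : finGroupType) (pi : nat_pred) (G : {group gT}) :
  Prop :=
  exists s : seq {group gT},
    [/\ forall K : {group gT}, K \in s -> K <| G,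
        path (pi_factor pi) 1%G s
      & last 1%G s = G].

Definition has_normal_complement (gT : finGroupType) (G C : {set gT}) : Prop :=
  exists2 N : {group gT}, N <| G & N \in [complements to C in G].

(* Main.v *)
Require Import Defs.
From HB Require Import structures.
From mathcomp Require Import all_boot all_fingroup all_solvable ssralg.

Set Implicit Arguments.
Unset Strict Implicit.
Unset Printing Implicit Defensive.

Local Open Scope group_scope.

(** Write pi for the set of primes dividing |H| and N for the normaliser of
    H.

    A nontrivial subgroup P of H has its normaliser inside N, since H and any
    conjugate of H by an element normalising P share P. Taking for P a Sylow
    subgroup of H, this makes the Hall subgroup H of N a Hall subgroup of G
    ([TI_subgroup_Hall]). Applying it instead to a Sylow subgroup of the
    first pi-factor of a pi-series, the Frattini argument yields a normal
    pi'-subgroup A with G = A N ([pi_separable_TI_Hall]).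

    The same remark with P = <[h]> shows that every nontrivial h in H has the
    same centraliser in A as H itself. That centraliser is not A, for
    otherwise G = A N would normalise H; and then H contains no elementary
    abelian subgroup of order p^2 ([semiprime_p2]): otherwise every
    nontrivial element of such a subgroup would act without fixed points on
    some nontrivial abelian section V of A, and summing the norms of its
    subgroups of order p would give p V = 0, although p is coprime to |V|.
    Hence a Sylow p-subgroup of H is cyclic: for odd p because its p-rank is
    at most 1, for p = 2 because it is abelian as well.

    So H is a Z-group, hence solvable ([Zgroup_sol], by transfer into the
    Sylow subgroup for the smallest prime). Let C be the centraliser of Q in
    H and D = [H, Q]; coprime action gives H = D C. A coprime action on a
    cyclic p-group is trivial or fixed-point-free, so C contains a full Sylow
    p-subgroup of H for each prime p dividing |C|, and C is a Hall subgroup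
    of H ([coprime_Zgroup_cent_Hall]). A Sylow subgroup of D centralised by Q
    would lie in D' and be central in D, which is absurd, so D and C
    intersect trivially ([coprime_Zgroup_comm_cent_TI]). Now D Q is normal in
    N = H Q, hence A D Q is normal in A N = G; its order is coprime to |C|,
    and together with C it generates G. *)

(** * Fixed points of coprime actions *)

Section AbelianAction.

Import GRing.Theory FiniteModule.
Local Open Scope ring_scope.

(** The norm of v under <[x]> is a fixed point of x. *)
Lemma cent1_cycle_sum (gT : finGroupType) (V : {group gT}) (abV : abelian V)
    (x : gT) (v : fmod_of abV) :
  x \in 'N(V) -> 'C_V[x] = 1%g -> \sum_(k < #[x]) v ^@ (x ^+ k)%g = 0.
Proof.
move=> nVx cVx1; set s := \sum_(k < _) _.
have fix_s: s ^@ x = s.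
  rewrite (actr_sum x) /s.
  case: #[x]%g (order_gt0 x) (expg_order x) => // n _ xn1.
  rewrite big_ord_recr big_ord_recl /= addrC -actrM ?groupX // -expgSr xn1.
  by congr (_ + _); apply: eq_bigr => i _; rewrite -actrM ?groupX // -expgSr.
apply: val_inj; rewrite /= [RHS]fmval0; apply/set1gP.
rewrite -cVx1 inE fmodP /=.
apply/cent1P/commgP/conjg_fixP.
by rewrite -fmvalJ ?fix_s.
Qed.

(** If a and b generate E then each of the subgroups <[a b^i]> with i < p, and
    <[b]>, has trivial norm on V.  Summing the norms of the <[a b^i]> and
    collecting the terms by powers of a leaves p v plus translates of norms of
    powers of b, so p v = 0. *)
Lemma semiregular_p2_abelian (gT : finGroupType) (p : nat) (V E : {group gT}) :
    abelian V -> E \subset 'N(V) -> coprime #|V| #|E| ->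
    E \in 'E_p^2(E) -> semiregular V E ->
  V :=: 1%g.
Proof.
move=> abV nVE coVE EpE regVE; have [_ abelE oE] := pnElemPcard EpE.
have p_pr : prime p by case: (pnElem_prime EpE).
have [pE cEE expE] := and3P abelE.
have oEx x : x \in E^#%g -> #[x]%g = p.
  by case/setD1P=> ntx Ex; apply: (abelem_order_p abelE).
have [b Eb] : exists b, b \in E^#%g.
  apply/set0Pn; rewrite setD_eq0 subG1 -cardG_gt1 oE.
  by rewrite (ltn_exp2l 0) ?prime_gt1.
have ob := oEx b Eb; have [ntb bE] := setD1P Eb.
have [a Ea nba] : exists2 a, a \in E & a \notin <[b]>%g.
  apply/subsetPn/negP=> /subset_leq_card; rewrite oE -/(order b) ob.
  by rewrite leqNgt -{1}[p]expn1 ltn_exp2l ?prime_gt1.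
have norm0 x (v : fmod_of abV) :
    x \in E^#%g -> \sum_(k < p) v ^@ (x ^+ k)%g = 0.
  move=> Ex; rewrite -(oEx _ Ex) cent1_cycle_sum ?regVE //.
  by rewrite (subsetP nVE) //; case/setD1P: Ex.
have pv0 (v : fmod_of abV) : v *+ p = 0.
  have <- : \sum_(i < p) \sum_(k < p) v ^@ ((a * b ^+ i) ^+ k)%g = v *+ p.
    rewrite exchange_big /= (bigD1 (Ordinal (prime_gt0 p_pr))) //=.
    (* For k != 0 the k-th inner sum is the norm of b^k at v^(a^k). *)
    rewrite [X in _ + X]big1 ?addr0; last first.
      move=> k nt_k; pose w := v ^@ (a ^+ k)%g.
      rewrite -[RHS](norm0 (b ^+ k)%g w); first apply: eq_bigr => i _.
        rewrite /w -actrM ?(subsetP nVE) ?groupX //; congr (_ ^@ _).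
        rewrite expgMn; last by apply: (centsP cEE); rewrite ?groupX.
        by rewrite -!expgM mulnC.
      rewrite !inE groupX // andbT -order_dvdn ob gtnNdvd //.
      by rewrite lt0n; apply: contra nt_k => /eqP k0; apply/eqP/val_inj.
    rewrite (eq_bigr (fun=> v)) ?sumr_const ?card_ord // => i _.
    by rewrite expg0 actr1.
  apply: big1 => i _; apply: norm0.
  rewrite !inE groupM ?groupX // andbT.
  apply: contra nba => /eqP/(canRL (mulgK _)) ->.
  by rewrite mul1g groupV mem_cycle.
apply/trivgP/subsetP=> x Vx; apply/set1P.
have copV : coprime #|V| p by rewrite (coprime_dvdr _ coVE) // oE dvdn_exp.
rewrite -(expgK copV Vx) (_ : x ^+ p = 1)%g ?expg1n //.
by rewrite -(fmodK abV Vx) -fmvalZ pv0.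
Qed.
End AbelianAction.

Lemma sol_coprime_comm_cent (gT : finGroupType) (A G : {group gT}) :
  A \subset 'N(G) -> coprime #|G| #|A| -> solvable G ->
  [~: G, A] * 'C_G(A) = G.
Proof.
move=> nGA coGA solG; have sRG : [~: G, A] \subset G by rewrite commg_subl.
have nRG : G \subset 'N([~: G, A]) := commg_norml G A.
have nRA : A \subset 'N([~: G, A]) := commg_normr A G.
have sCG : 'C_G(A) \subset G := subsetIl G _.
apply/eqP; rewrite eqEsubset mul_subG //= -quotientSK //.
rewrite (coprime_quotient_cent sRG) //.
by rewrite subsetI subxx quotient_cents2 /=.
Qed.

Lemma sol_coprime_commG2 (gT : finGroupType) (A G : {group gT}) :
  A \subset 'N(G) -> coprime #|G| #|A| -> solvable G ->
  [~: G, A, A] = [~: G, A].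
Proof.
move=> nGA coGA solG; apply/eqP; rewrite eqEsubset commg_subl commg_normr /=.
rewrite -{1}(sol_coprime_comm_cent nGA coGA solG) gen_subG.
apply/subsetP=> _ /imset2P[_ a /mulsgP[r c Rr /setIP[Gc cAc] ->] Aa ->].
rewrite commMgJ (_ : [~ c, a] = 1) ?mulg1; last first.
  by apply/eqP/commgP; exact: (centP cAc).
have nRAc : 'C_G(A) \subset 'N([~: G, A, A]).
  have nAC : 'C_G(A) \subset 'N(A) by rewrite subIset // cent_sub orbT.
  by rewrite !normsR // subIset ?normG.
by rewrite memJ_norm ?mem_commg // (subsetP nRAc) // inE Gc cAc.
Qed.

(** Along the derived series of K: once E centralises K', the centralisers in
    K / K' are the images of those in K, so E acts semiregularly on the abelian
    group [K, E] K' / K', which is therefore trivial.  Then [K, E, E] = 1,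
    and [K, E] = [K, E, E] by coprimality. *)
Lemma semiprime_p2_sol (gT : finGroupType) (p : nat) (K E : {group gT}) :
    solvable K -> E \subset 'N(K) -> coprime #|K| #|E| ->
    E \in 'E_p^2(E) -> semiprime K E ->
  E \subset 'C(K).
Proof.
move=> solK nKE coKE EpE; have [n] := ubnP #|K|.
elim: n => // n IHn in K solK nKE coKE * => /ltnSE-leKn prKE.
have [-> | ntK] := eqsVneq K 1; first exact: cents1.
have nK'E : E \subset 'N(K^`(1)) := gFnorm_trans _ nKE.
have sK'K : K^`(1) \subset K := der_sub 1 K.
have coK'E : coprime #|K^`(1)| #|E| := coprimeSg sK'K coKE.
have cK'E : E \subset 'C(K^`(1)).
  apply: IHn; rewrite ?(solvableS sK'K) //; last exact: semiprimeS prKE.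
  by apply: leq_trans leKn; rewrite proper_card ?(sol_der1_proper solK).
pose W := [~: K, E]%G; have nWE : E \subset 'N(W) := commg_normr E K.
have sWK : W \subset K by rewrite commg_subl.
have nK'W : W \subset 'N(K^`(1)) := subset_trans sWK (der_norm 1 K).
have coWE : coprime #|W| #|E| := coprimeSg sWK coKE.
suffices sWK' : W \subset K^`(1).
  rewrite centsC; apply/commG1P; rewrite -sol_coprime_commG2 //.
  by apply/commG1P; rewrite (subset_trans sWK') // centsC.
pose V := (W / K^`(1))%G.
have abV : abelian V by rewrite (abelianS (quotientS _ sWK)) ?sub_der1_abelian.
have defV : V :=: [~: K / K^`(1), E / K^`(1)] by rewrite -quotientR // der_norm.
have coVE : coprime #|K / K^`(1)| #|E / K^`(1)| by rewrite coprime_morph.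
have cV1 : 'C_V(E / K^`(1)) = 1.
  by rewrite defV coprime_abel_cent_TI ?quotient_norms ?sub_der1_abelian.
rewrite -quotient_sub1 // -[_ / _]/(V : {set _}).
have tiEK' : E :&: K^`(1) = 1 by rewrite setIC coprime_TIg.
have /isogP[f injf imf] : E \isog E / K^`(1).
  by rewrite quotient_isog // setIC.
have EpEq : (E / K^`(1))%G \in 'E_p^2(E / K^`(1)).
  have [_ abelE oE] := pnElemP EpE.
  apply/pnElemP; split=> //; first by rewrite quotient_abelem.
  by rewrite -imf card_injm.
apply/trivgP; apply: (@semiregular_p2_abelian _ p V (E / K^`(1))%G) => //.
- by rewrite quotient_norms.
- by rewrite (coprimeSg _ coVE) // quotientS.
move=> xb /setD1P[ntx /morphimP[x nx Ex def_x]].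
rewrite def_x in ntx *.
have E1x : x \in E^#.
  by rewrite !inE Ex andbT; apply: contraNneq ntx => ->; rewrite morph1.
have sVK : V \subset K / K^`(1) by rewrite quotientS.
have sxE : <[x]> \subset E by rewrite cycle_subG.
suffices sCV : 'C_V[coset K^`(1) x] \subset 'C(E / K^`(1)).
  by apply/trivgP; rewrite -cV1 subsetI subsetIl.
rewrite -cent_cycle -quotient_cycle //.
apply: subset_trans (setSI _ sVK) _.
rewrite -coprime_quotient_cent ?(subset_trans sxE) //; last first.
  exact: coprimegS coKE.
by rewrite cent_cycle prKE // quotient_cents // subsetIr.
Qed.

(** Coprime action provides an E-invariant Sylow q-subgroup of K for every prime
    q, and these are solvable; so the centraliser of E in K has full order. *)
Lemma semiprime_p2 (gT : finGroupType) (p : nat) (K E : {group gT}) :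
    E \subset 'N(K) -> coprime #|K| #|E| -> E \in 'E_p^2(E) ->
    semiprime K E ->
  E \subset 'C(K).
Proof.
move=> nKE coKE EpE prKE.
have solE : solvable E.
  by have [_ /abelem_abelian/abelian_sol] := pnElemP EpE.
suffices: K \subset 'C_K(E) by rewrite subsetI subxx centsC.
suffices oK : #|K| %| #|'C_K(E)|.
  have -> : 'C_K(E) = K by apply/eqP; rewrite eqEcard subsetIl dvdn_leq.
  exact: subxx.
apply/(dvdn_partP _ (cardG_gt0 _)) => q _.
have [P sylP nPE] := sol_coprime_Sylow_exists q solE nKE coKE.
have [sPK qP _] := and3P sylP.
rewrite -(card_Hall sylP) cardSg // subsetI sPK centsC.
apply: semiprime_p2_sol EpE _ => //; first exact: pgroup_sol qP.
  exact: coprimeSg coKE.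
exact: semiprimeS prKE.
Qed.

(** A subgroup of H of type (p, p) would centralise K by [semiprime_p2], and
    then so would H, since both have the same centraliser in K. So all
    p-ranks are at most 1; for p = 2 the commutativity of S excludes
    quaternion groups. *)
Lemma semiprime_Zgroup (gT : finGroupType) (K H S : {group gT}) :
    H \subset 'N(K) -> coprime #|K| #|H| -> semiprime K H ->
    ~~ (H \subset 'C(K)) -> 2.-Sylow(H) S -> abelian S ->
  Zgroup H.
Proof.
move=> nKH coKH prKH ncKH sylS abS.
apply/forall_inP=> P /SylowP[p p_pr sylP]; have [sPH pP _] := and3P sylP.
have rP : 'r_p(P) <= 1.
  rewrite leqNgt; apply/negP=> /p_rank_geP[E EpE].
  have [sEP abelE oE] := pnElemPcard EpE.
  have EpEE : E \in 'E_p^2(E) by apply/pnElemP; case/pnElemP: EpE.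
  have sEH := subset_trans sEP sPH.
  have cKE : E \subset 'C(K).
    apply: semiprime_p2 EpEE _; first exact: subset_trans nKH.
      exact: coprimegS coKH.
    exact: semiprimeS prKH.
  have ntE : E :!=: 1 by rewrite -cardG_gt1 oE (ltn_exp2l 0) ?prime_gt1.
  case/negP: ncKH; rewrite centsC -subsetIidl.
  by rewrite -(cent_semiprime prKH sEH ntE) subsetI subxx centsC.
have [p2 | odd_p] := even_prime p_pr; last first.
  by rewrite (odd_pgroup_rank1_cyclic pP) // (odd_pgroup_odd odd_p pP).
rewrite p2 in sylP pP rP; have [x _ defP] := Sylow_trans sylS sylP.
by rewrite abelian_rank1_cyclic ?(rank_pgroup pP) // defP abelianJ.
Qed.

(** * Transfer and Z-groups *)

(** Burnside's fusion argument: P and P :^ x are both Sylow in the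
    centraliser of u ^ x, and an element c of that centraliser carrying one
    to the other makes x c normalise, hence centralise, P. *)
Lemma abelian_Sylow_fusion (gT : finGroupType) (p : nat) (G P : {group gT})
    (u x : gT) :
    p.-Sylow(G) P -> abelian P -> 'N_G(P) \subset 'C(P) ->
    x \in G -> u \in P -> u ^ x \in P ->
  u ^ x = u.
Proof.
move=> sylP abP cNP Gx Pu Pux; pose C := 'C_G[u ^ x].
have [sPG pP _] := and3P sylP.
have sylC (R : {group gT}) :
    p.-Sylow(G) R -> R \subset 'C[u ^ x] -> p.-Sylow(C) R.
  move=> sylR cRux; rewrite (pHall_subl _ (subsetIl _ _) sylR) // subsetI cRux.
  by rewrite (pHall_sub sylR).
have sylPC : p.-Sylow(C) P by apply: sylC; rewrite // sub_cent1 (subsetP abP).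
have sylPxC : p.-Sylow(C) (P :^ x).
  by apply: sylC; rewrite ?pHallJ // cent1J conjSg sub_cent1 (subsetP abP).
have [c /setIP[Gc /cent1P cc] /= defP] := Sylow_trans sylPxC sylPC.
have NPxc : x * c \in 'N_G(P) by rewrite inE groupM //= inE conjsgM -defP.
have cPxc := subsetP cNP _ NPxc.
rewrite -[RHS](_ : u ^ (x * c) = u); last first.
  by rewrite conjgE -(centP cPxc) // mulKg.
by rewrite conjgM [RHS]conjgE -cc mulKg.
Qed.

(** By the fusion lemma the transfer of G into P is g |-> g ^+ #|G : P| on P,
    hence injective there; its kernel is the complement. *)
Lemma Burnside_normal_complement (gT : finGroupType) (p : nat)
    (G P : {group gT}) :
    p.-Sylow(G) P -> abelian P -> 'N_G(P) \subset 'C(P) ->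
  exists N : {group gT}, N ><| P = G.
Proof.
move=> sylP abP cNP; have [sPG pP _] := and3P sylP.
have abP' : abelian (idm P @* P) by rewrite morphim_idm.
have sPP : P \subset idm P @* P by rewrite morphim_idm.
pose V := transfer_morphism G abP'.
have defV g : g \in P -> V g = (FiniteModule.fmod abP' g *+ #|G : P|)%R.
  move=> Pg; have Gg := subsetP sPG g Pg.
  have trX := transversalP (rcosets_cycle_partition sPG Gg).
  set X := transversal _ _ in trX; have sXG := subsetP (transversal_sub trX).
  rewrite /V /= (transfer_cycle_expansion sPG abP' Gg trX).
  rewrite -(sum_index_rcosets_cycle sPG Gg trX) -GRing.sumrMnr.
  apply: eq_bigr => x Xx; set n := #|_ : _| => /=.
  have Pgn : g ^+ n \in P by rewrite groupX.
  rewrite /restrm /= -(FiniteModule.fmodX _ _ (subsetP sPP g Pg)).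
  rewrite (abelian_Sylow_fusion sylP abP cNP) // ?groupV ?sXG //.
  by have:= mulg_exp_card_rcosets P g x; rewrite mem_rcoset conjgE invgK mulgA.
have tiVP : 'ker V :&: P = 1.
  apply/trivgP/subsetP=> g /setIP[/mker Vg1 Pg]; apply/set1P.
  have coPG : coprime #|P| #|G : P| by case/andP: (pHall_Hall sylP).
  rewrite -(expgK coPG Pg) (_ : g ^+ #|G : P| = 1) ?expg1n //.
  rewrite -(FiniteModule.fmodK abP' (subsetP sPP _ (groupX _ Pg))).
  rewrite FiniteModule.fmodX ?(subsetP sPP) // -defV //.
  by rewrite Vg1.
exists ('ker V)%G; rewrite sdprodE ?(subset_trans sPG) ?ker_norm //.
apply/eqP; rewrite eqEcard mul_subG ?subsetIl //= TI_cardMg //.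
have nsVG : 'ker V <| G := ker_normal V.
rewrite -(Lagrange (normal_sub nsVG)) leq_pmul2l ?cardG_gt0 //.
rewrite -card_quotient ?normal_norm // (card_isog (first_isog V)).
rewrite (leq_trans (subset_leq_card (subsetT _))) // cardsT.
by rewrite card_sub /= morphim_idm //; apply: eq_leq; apply: eq_card.
Qed.

(** The automizer of P has order dividing (p - 1) p^k, so no prime divisor of
    |G| other than p can divide it, and p does not either since P is abelian. *)
Lemma cyclic_pdiv_Sylow_cent (gT : finGroupType) (G P : {group gT}) :
  (pdiv #|G|).-Sylow(G) P -> cyclic P -> 'N_G(P) \subset 'C(P).
Proof.
set p := pdiv _ => sylP cycP; have [sPG pP _] := and3P sylP.
have [P1 | ntP] := eqsVneq P 1; first by rewrite P1 cent1T subsetT.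
have [p_pr _ [k oP]] := pgroup_pdiv pP ntP.
have nPM : 'N_G(P) \subset 'N(P) := subsetIr G _.
pose f := conj_aut_morphism P; have sPM : P \subset 'N_G(P).
  by rewrite subsetI sPG normG.
have fP1 : f @* P = 1.
  apply/trivgP/subsetP=> _ /morphimP[x _ Px ->]; apply/set1P/mker.
  by rewrite ker_conj_aut (subsetP (cyclic_abelian cycP)).
have pfM : p.-group (f @* 'N_G(P)).
  apply/pgroupP=> q q_pr q_dv.
  have le_pq : p <= q.
    apply: pdiv_min_dvd; first exact: prime_gt1.
    rewrite (dvdn_trans q_dv) // (dvdn_trans (dvdn_morphim _ _)) //.
    by rewrite cardSg ?subsetIl.
  have := dvdn_trans q_dv (cardSg (Aut_conj_aut P 'N_G(P))).
  rewrite card_Aut_cyclic // oP totient_pfactor // Euclid_dvdM //.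
  case/orP=> [/dvdn_leq leqp1 | ].
    suffices: q < p by rewrite ltnNge le_pq.
    rewrite -(prednK (prime_gt0 p_pr)) ltnS leqp1 //.
    by rewrite -ltnS prednK ?prime_gt0 ?prime_gt1.
  by rewrite Euclid_dvdX // => /andP[]; rewrite dvdn_prime2.
have sylPM : p.-Sylow('N_G(P)) P by rewrite (pHall_subl sPM _ sylP) ?subsetIl.
have fM1 : f @* 'N_G(P) = 1.
  by rewrite -(pHall_id (morphim_pHall f (normG P) sylPM) pfM).
apply/subsetP=> x Mx; rewrite -(ker_conj_aut P).
have nPx := subsetP nPM x Mx.
have: f x \in f @* 'N_G(P) := mem_morphim f nPx Mx.
by rewrite fM1 => /set1P fx1; apply/kerP.
Qed.

Lemma Zgroup_sol (gT : finGroupType) (G : {group gT}) : Zgroup G -> solvable G.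
Proof.
have [n] := ubnP #|G|; elim: n => // n IHn in G * => /ltnSE-leGn zgG.
have [-> | ntG] := eqsVneq G 1; first exact: solvable1.
have p_pr : prime (pdiv #|G|) by rewrite pdiv_prime ?cardG_gt1.
have [P sylP] := Sylow_exists (pdiv #|G|) G.
have cycP : cyclic P by apply: (forall_inP zgG); apply: p_Sylow sylP.
have [N defG] := Burnside_normal_complement sylP (cyclic_abelian cycP)
  (cyclic_pdiv_Sylow_cent sylP cycP).
have [nsNG _ _ _ _] := sdprod_context defG.
rewrite (series_sol nsNG) -(isog_sol (sdprod_isog defG)).
rewrite (abelian_sol (cyclic_abelian cycP)) andbT.
apply: IHn (ZgroupS (normal_sub nsNG) zgG).
apply: leq_trans leGn; rewrite -(sdprod_card defG) ltn_Pmulr //.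
by rewrite (card_Hall sylP) p_part_gt1 mem_primes p_pr cardG_gt0 pdiv_dvd.
Qed.

(** The last term of the derived series of C = 'C_G('F(G)) not contained in
    'F(G) would have its derived subgroup in 'F(G), which it centralises; so it
    would be nilpotent of class at most 2, and thus contained in 'F(G). *)
Lemma sol_cent_Fitting (gT : finGroupType) (G : {group gT}) :
  solvable G -> 'C_G('F(G)) \subset 'F(G).
Proof.
move=> solG; pose C := 'C_G('F(G))%G.
have nsCG : C <| G.
  have := subcent_normal G 'F(G).
  by rewrite (setIidPl (normal_norm (Fitting_normal G))).
have /ex_minnP[[|i] //] : exists i, C^`(i) \subset 'F(G).
  have /derivedP[i Ci1] : solvable C := solvableS (normal_sub nsCG) solG.
  by exists i; rewrite Ci1 sub1G.
move=> sC'F min_i; have: C^`(i) \subset 'F(G).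
  apply: Fitting_max; first exact: gFnormal_trans.
  apply: small_nil_class; apply: (@leq_trans 2) => //.
  rewrite nil_class2 subsetI der_sub /=.
  apply: subset_trans sC'F _; rewrite centsC.
  exact: subset_trans (der_sub i C) (subsetIr G _).
by move/min_i; rewrite ltnn.
Qed.

(** X acts on Y through the abelian group of automorphisms of a cyclic group. *)
Lemma cyclic_der1_cent (gT : finGroupType) (X Y : {group gT}) :
  cyclic Y -> X \subset 'N(Y) -> X^`(1) \subset 'C(Y).
Proof.
move=> cycY nYX; pose f := conj_aut_morphism Y.
have fX'1 : f @* X^`(1) = 1.
  rewrite morphim_der //; apply/derG1P.
  exact: abelianS (Aut_conj_aut Y X) (Aut_cyclic_abelian cycY).
apply/subsetP=> x X'x; rewrite -(ker_conj_aut Y).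
have nYx : x \in 'N(Y) := subsetP nYX x (subsetP (der_sub 1 X) x X'x).
have: f x \in f @* X^`(1) := mem_morphim f nYx X'x.
by rewrite fX'1 => /set1P fx1; apply/kerP.
Qed.

(** The subgroups of P are linearly ordered by inclusion, whereas [P, A] and the
    centraliser of A in P intersect trivially; so one of them is trivial. *)
Lemma coprime_cyclic_pgroup_cent (gT : finGroupType) (p : nat)
    (P A : {group gT}) :
    cyclic P -> p.-group P -> A \subset 'N(P) -> coprime #|P| #|A| ->
    'C_P(A) != 1 ->
  A \subset 'C(P).
Proof.
move=> cycP pP nPA coPA; apply: contraR => ncPA.
have sRP : [~: P, A] \subset P by rewrite commg_subl.
have tiRC : [~: P, A] :&: 'C_P(A) = 1.
  by rewrite setIA (setIidPl sRP) coprime_abel_cent_TI ?cyclic_abelian.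
have sCP : 'C_P(A) \subset P := subsetIl P _.
have /orP[sRC | sCR] :
  ([~: P, A] \subset 'C_P(A)) || ('C_P(A) \subset [~: P, A]).
  rewrite -(cardSg_cyclic cycP sRP sCP) -(cardSg_cyclic cycP sCP sRP).
  rewrite (card_pgroup (pgroupS sRP pP)) (card_pgroup (pgroupS sCP pP)).
  have /orP[le_RC | le_CR] :=
      leq_total (logn p #|[~: P, A]|) (logn p #|'C_P(A)|).
    by rewrite (dvdn_exp2l _ le_RC).
  by rewrite (dvdn_exp2l _ le_CR) orbT.
  case/negP: ncPA; rewrite centsC; apply/commG1P.
  by rewrite -tiRC (setIidPl sRC).
by rewrite -tiRC (setIidPr sCR).
Qed.

(** * Coprime actions on Z-groups *)

(** A Q-invariant Sylow p-subgroup of H containing a Sylow p-subgroup of the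
    centraliser of Q has a nontrivial fixed point, hence is centralised by Q. *)
Lemma coprime_Zgroup_cent_Sylow (gT : finGroupType) (p : nat)
    (H Q : {group gT}) :
    Zgroup H -> Q \subset 'N(H) -> coprime #|H| #|Q| ->
    p \in \pi('C_H(Q)) ->
  exists2 P : {group gT}, p.-Sylow(H) P & P \subset 'C_H(Q).
Proof.
move=> zgH nHQ coHQ pi_p; have [R sylR] := Sylow_exists p 'C_H(Q).
have [sRC pR _] := and3P sylR; have [sRH cQR] := subsetIP sRC.
have nRQ : Q \subset 'N(R) by rewrite cents_norm // centsC.
have [P [sylP nPQ sRP]] :=
  coprime_Hall_subset nHQ coHQ (Zgroup_sol zgH) sRH pR nRQ.
have [sPH pP _] := and3P sylP.
exists P; rewrite // subsetI sPH centsC.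
apply: coprime_cyclic_pgroup_cent pP nPQ _ _.
- by apply: (forall_inP zgH); apply: p_Sylow sylP.
- exact: coprimeSg coHQ.
apply: contraTneq pi_p => CP1; rewrite -p'groupEpi -partG_eq1 -(card_Hall sylR).
by rewrite -trivg_card1 -subG1 -CP1 subsetI sRP.
Qed.

Lemma coprime_Zgroup_cent_Hall (gT : finGroupType) (H Q : {group gT}) :
  Zgroup H -> Q \subset 'N(H) -> coprime #|H| #|Q| -> Hall H 'C_H(Q).
Proof.
move=> zgH nHQ coHQ; apply: (@pHall_Hall _ \pi('C_H(Q))).
rewrite /pHall subsetIl pgroup_pi; apply/pnatP=> // p p_pr p_dv.
apply/negP=> pi_p.
have [P /and3P[_ _ p'HP] sPC] := coprime_Zgroup_cent_Sylow zgH nHQ coHQ pi_p.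
move: p'HP; rewrite p'natE // => /negP; apply.
by apply: dvdn_trans p_dv _; apply: indexgS.
Qed.

(** Put D = [H, Q], so that D = [D, Q] and Q has no fixed point on D / D'. If
    Q centralises a Sylow p-subgroup P of D then P lies in D', which is
    contained in the cyclic group 'F(D) because D / 'C_D('F(D)) is abelian.
    Hence P is normal in D <*> Q and cyclic, so it is centralised by the
    derived subgroup of D <*> Q and in particular by D = [D, Q]. Being a
    central Hall subgroup, P splits off as a direct factor of D and meets D'
    trivially, so P = 1. *)
Lemma coprime_Zgroup_comm_cent_TI (gT : finGroupType) (H Q : {group gT}) :
    Zgroup H -> Q \subset 'N(H) -> coprime #|H| #|Q| ->
  [~: H, Q] :&: 'C_H(Q) = 1.
Proof.
move=> zgH nHQ coHQ; have solH := Zgroup_sol zgH.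
pose D := [~: H, Q]%G; have sDH : D \subset H by rewrite commg_subl.
have zgD : Zgroup D := ZgroupS sDH zgH.
have solD : solvable D := solvableS sDH solH.
have nDQ : Q \subset 'N(D) := commg_normr Q H.
have coDQ : coprime #|D| #|Q| := coprimeSg sDH coHQ.
have defD : [~: D, Q] = D := sol_coprime_commG2 nHQ coHQ solH.
rewrite setIA (setIidPl sDH).
have [// | ntC] := eqVneq 'C_D(Q) 1.
have [p pi_p] : exists p, p \in \pi('C_D(Q)).
  by exists (pdiv #|'C_D(Q)|); rewrite pi_pdiv cardG_gt1.
have [P sylP sPC] := coprime_Zgroup_cent_Sylow zgD nDQ coDQ pi_p.
have [sPD cPQ] := subsetIP sPC.
have sCD' : 'C_D(Q) \subset D^`(1).
  have nD'Q : Q \subset 'N(D^`(1)) := gFnorm_trans _ nDQ.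
  rewrite -quotient_sub1 ?subIset ?der_norm //.
  rewrite coprime_quotient_cent ?der_sub //.
  rewrite -{1}defD quotientR ?der_norm // coprime_abel_cent_TI //.
  - by rewrite quotient_norms.
  - by rewrite coprime_morph.
  exact: sub_der1_abelian.
have cycF : cyclic 'F(D).
  exact: nil_Zgroup_cyclic (ZgroupS (Fitting_sub D) zgD) (Fitting_nil D).
have sD'F : D^`(1) \subset 'F(D).
  apply: subset_trans (sol_cent_Fitting solD).
  by rewrite subsetI der_sub cyclic_der1_cent ?normal_norm ?Fitting_normal.
have sPF : P \subset 'F(D) := subset_trans (subset_trans sPC sCD') sD'F.
have nsPD : P <| D.
  by apply: char_normal_trans (Fitting_normal D); rewrite sub_cyclic_char.
have cPD : D \subset 'C(P).
  have: (D <*> Q)^`(1) \subset 'C(P).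
    rewrite cyclic_der1_cent ?(cyclicS sPF) // join_subG normal_norm //.
    by rewrite cents_norm // centsC.
  by apply: subset_trans; rewrite -{1}defD commgSS ?joing_subl ?joing_subr.
have /splitsP[B /complP[tiPB defPB]] : [splits D, over P].
  by rewrite SchurZassenhaus_split // (pHall_Hall sylP).
have sBD : B \subset D by rewrite -defPB mulG_subr.
have nsBD : B <| D.
  rewrite /normal sBD -{1}defPB mul_subG ?normG //.
  by rewrite cents_norm // centsC (subset_trans sBD).
have sD'B : D^`(1) \subset B.
  rewrite der1_min ?normal_norm // -defPB quotientMidr quotient_abelian //.
  exact: cyclic_abelian (cyclicS sPF cycF).
have P1 : P :=: 1.
  rewrite -tiPB; apply/esym/setIidPl.
  exact: subset_trans (subset_trans sPC sCD') sD'B.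
have := piSg (subsetIl D 'C(Q)) pi_p.
rewrite -[p \in _]negbK -p'groupEpi -partG_eq1 -(card_Hall sylP).
by rewrite P1 cards1.
Qed.

(** * Trivial intersection subgroups *)

Lemma TI_subgroup_norm (gT : finGroupType) (G H P : {group gT}) :
  TI_subgroup G H -> P \subset H -> P :!=: 1 -> 'N_G(P) \subset 'N_G(H).
Proof.
move=> [_ tiH] sPH ntP; apply/subsetP=> x /setIP[Gx nPx].
rewrite in_setI Gx -groupV inE sub_conjgV.
have [HHx | HHx1] := tiH x Gx; first by rewrite -{1}HHx subsetIr.
case/eqP: ntP; apply/trivgP; rewrite -HHx1 subsetI sPH.
by rewrite -(normP nPx) conjSg.
Qed.

(** A Sylow subgroup P of H is Sylow in N_G(H), hence in the smaller group
    N_G(P), and a subgroup that is Sylow in its normaliser is Sylow in G. *)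
Lemma TI_subgroup_Hall (gT : finGroupType) (G H : {group gT}) :
  TI_subgroup G H -> Hall 'N_G(H) H -> Hall G H.
Proof.
move=> tiH hallH; have [sHG _] := tiH.
apply: (@pHall_Hall _ \pi(H)); rewrite /pHall sHG pgroup_pi.
apply/pnatP=> // p p_pr p_dv; apply/negP=> pi_p.
have [P sylP] := Sylow_exists p H; have [sPH pP _] := and3P sylP.
have ntP : P :!=: 1.
  by rewrite trivg_card1 (card_Hall sylP) partG_eq1 p'groupEpi negbK.
have sylPN : p.-Sylow('N_G(P)) P.
  apply: (pHall_subl _ (TI_subgroup_norm tiH sPH ntP)).
    by rewrite subsetI normG (subset_trans sPH).
  exact: subHall_Sylow (Hall_pi hallH) pi_p sylP.
rewrite Sylow_subnorm in sylPN.
have [_ _] := and3P sylPN; rewrite p'natE // => /negP; apply.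
by apply: dvdn_trans p_dv _; apply: indexgS.
Qed.

(** Let A < B be the first factor of the series with B not a pi'-group; it is
    a pi-factor, so B = A R with R = H :&: B nontrivial. For a nontrivial
    Sylow subgroup P of R the Frattini argument gives G = B N_G(P) = A R
    N_G(P), and both R and N_G(P) lie in N_G(H). *)
Lemma pi_separable_TI_Hall (gT : finGroupType) (G H : {group gT}) :
    TI_subgroup G H -> Hall G H -> H :!=: 1 -> pi_separable \pi(H) G ->
  exists A : {group gT},
    [/\ A <| G, \pi(H)^'.-group A & A * 'N_G(H) = G].
Proof.
move=> tiH hallH ntH [s [nsG]]; have [sHG _] := tiH.
move: hallH; set pi := \pi(H) => /Hall_pi hallH; have piH := pHall_pgroup hallH.
have: pi^'.-group (1%G : {group gT}) by apply: pgroup1.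
have: (1%G : {group gT}) <| G by apply: normal1.
elim: s 1%G => [|B s IHs] /= A in nsG * => nsAG pi'A.
  move=> _ AG; rewrite AG in pi'A; case/eqP: ntH.
  by rewrite -(setIid H) coprime_TIg // (pnat_coprime piH) -?pgroupE
    ?(pgroupS sHG).
case/andP=> /andP[sAB piAB] s_path s_last.
have nsBG : B <| G by rewrite nsG ?mem_head.
have nsG_s K : K \in s -> K <| G by move=> sK; rewrite nsG ?inE ?sK ?orbT.
have nAB : B \subset 'N(A) := subset_trans (normal_sub nsBG) (normal_norm nsAG).
have [pi'B | not_pi'B] := boolP (pi^'.-group B); first exact: IHs s_path s_last.
have{} piAB : pi.-group (B / A).
  by rewrite (pquotient_pgroup pi'A) ?(negPf not_pi'B) ?orbF in piAB.
have hallR : pi.-Hall(B) (H :&: B) := Hall_setI_normal nsBG hallH.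
have [sRB piR _] := and3P hallR; have nAR := subset_trans sRB nAB.
have defB : A * (H :&: B) = B.
  rewrite -quotientK // (pHall_id (quotient_pHall nAR hallR) piAB).
  by rewrite quotientGK // (normalS sAB (normal_sub nsBG)).
have [p p_pr p_dv] : exists2 p, prime p & p %| #|H :&: B|.
  exists (pdiv #|H :&: B|); rewrite ?pdiv_dvd // pdiv_prime //.
  by rewrite ltn_neqAle cardG_gt0 eq_sym (card_Hall hallR) partG_eq1 not_pi'B.
have [P sylP] := Sylow_exists p (H :&: B); have sPR := pHall_sub sylP.
have pi_p : p \in pi by apply: (pgroupP piR).
have sylPB : p.-Sylow(B) P := subHall_Sylow hallR pi_p sylP.
have ntP : P :!=: 1.
  rewrite trivg_card1 (card_Hall sylP) partG_eq1 p'groupEpi negbK.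
  by rewrite mem_primes p_pr p_dv cardG_gt0.
have sNPH : 'N_G(P) \subset 'N_G(H).
  exact: TI_subgroup_norm tiH (subset_trans sPR (subsetIl H B)) ntP.
exists A; split=> //; apply/eqP.
rewrite eqEsubset mul_subG ?subsetIl ?(normal_sub nsAG) //=.
rewrite -{1}(Frattini_arg nsBG sylPB) -{1}defB -mulgA mulgS // mul_subG //.
by rewrite subIset // subsetI sHG normG.
Qed.

(** * Normal complement of the centraliser *)

Theorem theorem1p6 (gT : finGroupType) (G H Q S : {group gT})
    (tiH : TI_subgroup G H) (nnH : ~~ (H <| G))
    (sepG : pi_separable \pi(H) G)
    (hallH : Hall 'N_G(H) H)
    (sylS : 2.-Sylow(H) S) (abelS : abelian S)
    (complQ : Q \in [complements to H in 'N_G(H)]) :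
  Hall G 'C_H(Q) /\ has_normal_complement G 'C_H(Q).
Proof.
have [sHG _] := tiH; have hallHG := TI_subgroup_Hall tiH hallH.
have ntH : H :!=: 1 by apply: contraNneq nnH => ->; apply: normal1.
have [A [nsAG pi'A defG]] := pi_separable_TI_Hall tiH hallHG ntH sepG.
have nAH : H \subset 'N(A) := subset_trans sHG (normal_norm nsAG).
have coHA : coprime #|H| #|A| by rewrite coprime_pi'.
have coAH : coprime #|A| #|H| by rewrite coprime_sym.
have sAG := normal_sub nsAG.
(* The centraliser of a nontrivial h in A normalises H, and normalising H is the
   same for an element of A as centralising it. *)
have prAH : semiprime A H.
  move=> h /setD1P[nth Hh]; apply/eqP; rewrite eqEsubset andbC.
  rewrite -{1}cent_set1 setIS ?centS ?sub1set //=.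
  rewrite -(coprime_norm_cent nAH coAH) subsetI subsetIl /=.
  have sNhH : 'N_G(<[h]>) \subset 'N_G(H).
    by apply: TI_subgroup_norm tiH _ _; rewrite ?cycle_subG ?cycle_eq1.
  apply: subset_trans (subset_trans sNhH (subsetIr G _)).
  by rewrite -cent_cycle setISS ?cent_sub.
have ncAH : ~~ (H \subset 'C(A)).
  apply: contra nnH => cAH; rewrite /normal sHG -{1}defG mul_subG ?subsetIr //.
  by rewrite cents_norm // centsC.
have zgH := semiprime_Zgroup nAH coAH prAH ncAH sylS abelS.
have [tiHQ defN] := complP complQ.
have [sHN sQN] : H \subset 'N_G(H) /\ Q \subset 'N_G(H).
  by rewrite -defN mulG_subl mulG_subr.
have [sQG nHQ] := subsetIP sQN.
have coHQ : coprime #|H| #|Q|.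
  have /andP[_] := hallH.
  by rewrite -divgS //= -defN TI_cardMg // mulKn.
have hallC := coprime_Zgroup_cent_Hall zgH nHQ coHQ.
have [sCH coC] := andP hallC; have sCG := subset_trans sCH sHG.
split.
  rewrite /Hall sCG -(Lagrange_index sHG sCH) coprimeMr coC.
  by have /andP[_] := hallHG; rewrite andbT; apply: coprimeSg.
pose D := [~: H, Q]%G; pose M := (D <*> Q)%G.
have nDQ : Q \subset 'N(D) := commg_normr Q H.
have sDH : D \subset H by rewrite commg_subl.
have defH : D * 'C_H(Q) = H.
  exact: sol_coprime_comm_cent nHQ coHQ (Zgroup_sol zgH).
(* M = D Q is the normal closure of Q in H Q. *)
have nMH : H \subset 'N(M).
  rewrite -commg_subr (subset_trans _ (joing_subl D Q)) //.
  have nDH : H \subset 'N(D) := commg_norml H Q.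
  rewrite -quotient_cents2 ?join_subG ?normG //.
  by rewrite quotientYidl // quotient_cents2r.
have nMN : 'N_G(H) \subset 'N(M).
  by rewrite -defN mul_subG // (subset_trans (joing_subr D Q)) ?normG.
have sMG : M \subset G by rewrite join_subG sQG (subset_trans sDH).
have nAM : M \subset 'N(A) := subset_trans sMG (normal_norm nsAG).
pose N := (A <*> M)%G.
have defMDQ : M :=: D * Q := norm_joinEr nDQ.
have defNAM : N :=: A * M := norm_joinEr nAM.
have sNG : N \subset G by rewrite join_subG sAG.
have nsNG : N <| G.
  rewrite /normal sNG -{1}defG mul_subG //.
    exact: subset_trans (joing_subl A M) (normG _).
  rewrite normsY // (subset_trans (subsetIl G _)) //; exact: normal_norm.
exists N; rewrite // inE; apply/andP; split.
  rewrite coprime_TIg // coprime_pi' ?cardG_gt0 //.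
  rewrite -pgroupE defNAM pgroupM defMDQ pgroupM.
  rewrite /pgroup -!coprime_pi' ?cardG_gt0 //.
  rewrite (coprimeSg sCH coHA) (coprimeSg sCH coHQ) andbT /=.
  suffices <- : #|H : 'C_H(Q)| = #|D| by rewrite coC.
  rewrite -divgS // -{1}defH TI_cardMg ?mulnK ?cardG_gt0 //.
  exact: coprime_Zgroup_comm_cent_TI.
have nNC : 'C_H(Q) \subset 'N(N) := subset_trans sCG (normal_norm nsNG).
rewrite -norm_joinEl // eqEsubset join_subG sCG sNG /=.
have sMT : M \subset 'C_H(Q) <*> N.
  exact: subset_trans (joing_subr A M) (joing_subr _ N).
rewrite -{1}defG -defN -{1}defH !mul_subG //.
- exact: subset_trans (joing_subl A M) (joing_subr _ N).
- exact: subset_trans (joing_subl D Q) sMT.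
- exact: joing_subl.
exact: subset_trans (joing_subr D Q) sMT.
Qed.
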